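(* If $\mathfrak{c}$ is a proper semisubtractive ideal of a semiring $S$, then $\mathfrak{c}=\bigcap\{\mathfrak{b}\mid\mathfrak{b}\text{ is an }s\text{-irreducible ideal of }S\text{ with }\mathfrak{c}\subseteq\mathfrak{b}\}$.
   Context: A semiring $S$ means a commutative semiring with multiplicative identity $1$, with $0\neq 1$. An ideal of $S$ is an additive submonoid $\mathfrak{a}$ of $S$ with $sx\in\mathfrak{a}$ for all $s\in S$, $x\in\mathfrak{a}$. $\mathcal{V}(S)$ denotes the set of elements $x\in S$ having an additive inverse $-x$ in $S$. An ideal $\mathfrak{a}$ is semisubtractive if $x\in\mathfrak{a}\cap\mathcal{V}(S)$ implies $-x\in\mathfrak{a}\cap\mathcal{V}(S)$. A semisubtractive ideal $\mathfrak{a}$ is $s$-irreducible if, for all semisubtractive ideals $\mathfrak{b},\mathfrak{b}'$ of $S$, $\mathfrak{b}\cap\mathfrak{b}'=\mathfrak{a}$ implies $\mathfrak{b}=\mathfrak{a}$ or $\mathfrak{b}'=\mathfrak{a}$. *)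

(* Defs.v *)
From HB Require Import structures.
From mathcomp Require Import all_boot all_order all_algebra.
From mathcomp Require Import all_classical.

Set Implicit Arguments.
Unset Strict Implicit.
Unset Printing Implicit Defensive.

Import GRing.Theory.
Local Open Scope classical_set_scope.
Local Open Scope ring_scope.

Section SemiringIdeals.
Variable S : comNzSemiRingType.
Implicit Types a b : set S.

Definition ideal a : Prop :=
  [/\ a 0, forall x y, a x -> a y -> a (x + y) & forall s x, a x -> a (s * x)].

Definition addinvertible : set S := [set x | exists y, x + y = 0].

(* A semiring has no total opposite; additive inverses are unique when they
   exist, so -x is the y such that x + y = 0. *)
Definition semisubtractive a : Prop :=
  forall x y, (a `&` addinvertible) x -> x + y = 0 ->
    (a `&` addinvertible) y.

Definition semisubtractive_ideal a : Prop := ideal a /\ semisubtractive a.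

(* As in the usual lattice-theoretic notion without a properness clause,
   the improper ideal setT is allowed to be s-irreducible. *)
Definition s_irreducible a : Prop :=
  semisubtractive_ideal a /\
  forall b b', semisubtractive_ideal b -> semisubtractive_ideal b' ->
    b `&` b' = a -> b = a \/ b' = a.

End SemiringIdeals.

(* Main.v *)
Require Import Defs.
From HB Require Import structures.
From mathcomp Require Import all_boot all_order all_algebra.
From mathcomp Require Import all_classical.
Local Open Scope classical_set_scope.
Local Open Scope ring_scope.

(** An element [x] outside [c] has to be separated from [c] by an s-irreducible
ideal.  The union of a nonempty chain of semisubtractive ideals is again one
([semisubtractive_ideal_bigcup]), so Zorn's lemma gives an ideal [a] that is
maximal among the semisubtractive ideals containing [c] and avoiding [x]
([maximal_avoiding_ideal]).  Every semisubtractive ideal strictly larger than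
[a] contains [x], hence so does the intersection of two of them, which
therefore cannot be [a]: the ideal [a] is s-irreducible
([s_irreducible_maximal_avoiding]). *)

(** A sum of two elements of the union is formed inside the larger of two
members of the chain; all other closure conditions concern one element at a
time, hence one member. *)
Lemma semisubtractive_ideal_bigcup (S : comNzSemiRingType)
    (F : set (set S)) :
  F !=set0 -> total_on F subset -> F `<=` @semisubtractive_ideal S ->
  semisubtractive_ideal (\bigcup_(a in F) a).
Proof.
move=> [a0 Fa0] totF FI; split; first split.
- by exists a0 => //; have [[]] := FI _ Fa0.
- move=> x y [a Fa ax] [b Fb by_].
  have [[_ aD _] _] := FI _ Fa; have [[_ bD _] _] := FI _ Fb.
  by case: (totF a b Fa Fb) => ab;
    [exists b => //; apply: bD => //; exact: ab
    |exists a => //; apply: aD => //; exact: ab].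
- move=> s x [a Fa ax]; exists a => //.
  by have [[_ _ aM] _] := FI _ Fa; exact: aM.
- move=> x y [[a Fa ax] Vx] xy0.
  by have [_ /(_ x y (conj ax Vx) xy0)[ay Vy]] := FI _ Fa; split=> //; exists a.
Qed.

Lemma maximal_avoiding_ideal (S : comNzSemiRingType) (c : set S) (x : S) :
  semisubtractive_ideal c -> ~ c x ->
  exists a, [/\ semisubtractive_ideal a, c `<=` a, ~ a x &
    forall b, semisubtractive_ideal b -> a `<` b -> b x].
Proof.
move=> cI ncx.
(* [Zorn_bigcup] also asks for the union of the empty chain, which is not an
   ideal; joining [c] to every set makes that union stand for [c] itself. *)
pose P A := semisubtractive_ideal (c `|` A) /\ ~ (c `|` A) x.
have [|A [[AI nAx] Amax]] := @Zorn_bigcup S P.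
  move=> F FP totF.
  pose G := c |` [set c `|` A | A in F].
  have cupE : c `|` \bigcup_(A in F) A = \bigcup_(a in G) a.
    apply/seteqP; split=> y.
      case=> [cy|[A FA Ay]]; first by exists c => //; left.
      by exists (c `|` A); [right; exists A|right].
    case=> a [-> cy|[A FA <-] [cy|Ay]]; [by left|by left|].
    by right; exists A.
  rewrite /P cupE.
  split; last by case=> a [->|[A /FP[_ nAx] <-]].
  apply: semisubtractive_ideal_bigcup.
  - by exists c; left.
  - move=> _ _ [->|[A FA <-]] [->|[B FB <-]].
    + by left.
    + by left; exact: subsetUl.
    + by right; exact: subsetUl.
    + by have [AB|BA] := totF A B FA FB; [left|right]; exact: setUS.
  - by move=> _ [->|[A /FP[AI _] <-]].
exists (c `|` A); split=> // b bI [ab nba].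
apply: contrapT => nbx; apply: (Amax b).
  split; first by move=> y Ay; apply: ab; right.
  by move=> bA; apply: nba => y /bA; right.
have cb : c `<=` b by move=> y cy; apply: ab; left.
by move/setUidPr: cb; rewrite /P => ->.
Qed.

(** If [b `&` b' = a] with [b] and [b'] both different from [a], then both are
strictly larger than [a], so [x] lies in [b], in [b'] and thus in [a]. *)
Lemma s_irreducible_maximal_avoiding (S : comNzSemiRingType) (a : set S)
    (x : S) :
  semisubtractive_ideal a -> ~ a x ->
  (forall b, semisubtractive_ideal b -> a `<` b -> b x) -> s_irreducible a.
Proof.
move=> aI nax amax; split=> // b b' bI b'I bb'a.
have bx d : semisubtractive_ideal d -> a `<=` d -> d <> a -> d x.
  move=> dI ad dNa; apply: amax => //; split=> // da.
  by apply: dNa; apply/seteqP.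
have [->|bNa] := pselect (b = a); first by left.
have [->|b'Na] := pselect (b' = a); first by right.
case: nax; rewrite -bb'a; split; apply: bx => //; rewrite -bb'a.
  exact: subIsetl.
exact: subIsetr.
Qed.

Theorem proposition2p18 (S : comNzSemiRingType) (c : set S)
  (c_semisub : semisubtractive_ideal c) (c_proper : c <> setT) :
  c = \bigcap_(b in [set b : set S | s_irreducible b /\ c `<=` b]) b.
Proof.
apply/seteqP; split=> [x cx b [_]|x cap_x]; first exact.
apply: contrapT => ncx.
have [a [aI ca nax amax]] := maximal_avoiding_ideal _ _ _ c_semisub ncx.
apply: (nax); apply: cap_x; split=> //.
exact: (s_irreducible_maximal_avoiding _ _ x).
Qed.
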